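(* Let $X$ be a biquandle, $A$ an abelian group, $\theta:X\times X\to A$ a biquandle $2$-cocycle, and $D$ a diagram of an oriented link in $\mathbb{R}^3$. Then the biquandle cocycle invariant with respect to $\theta$ can be considered as the shadow quandle cocycle invariant with respect to $\psi^*\theta$; that is, under the bijection $\Psi:\mathrm{Col}_{\mathcal{Q}(X)}(D)\to\mathrm{Col}_X(D)$, $$(\Phi_\theta(D))(\Psi(\mathcal{C}))=(\Phi^{S}_{\psi^*\theta}(D))(\mathcal{C})\quad\text{for every }\mathcal{C}\in\mathrm{Col}_{\mathcal{Q}(X)}(D).$$ In particular, when $X$ is finite, $\Phi_\theta(D)=\Phi^{S}_{\psi^*\theta}(D)$ in $\mathbb{Z}[A]$.
   Context: A quandle is a set $Q$ with a binary operation $\ast$ such that $a\ast a=a$; for every $a$ the map $\bullet\mapsto\bullet\ast a$ is bijective; and $(a\ast b)\ast c=(a\ast c)\ast(b\ast c)$. A biquandle is a set $X$ with binary operations $\underline{\ast},\overline{\ast}$ such that (BQ1) $x\,\underline{\ast}\,x=x\,\overline{\ast}\,x$; (BQ2) for every $x$ the maps $\bullet\mapsto\bullet\,\underline{\ast}\,x$ and $\bullet\mapsto\bullet\,\overline{\ast}\,x$ are bijective (with inverses $\underline{\ast}^{-1}x$, $\overline{\ast}^{-1}x$), and $(x,y)\mapsto(y\,\overline{\ast}\,x,x\,\underline{\ast}\,y)$ is a bijection of $X\times X$; (BQ3) $(x\underline{\ast}y)\underline{\ast}(z\underline{\ast}y)=(x\underline{\ast}z)\underline{\ast}(y\overline{\ast}z)$,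 $(x\overline{\ast}y)\overline{\ast}(z\overline{\ast}y)=(x\overline{\ast}z)\overline{\ast}(y\underline{\ast}z)$, $(x\underline{\ast}y)\overline{\ast}(z\underline{\ast}y)=(x\overline{\ast}z)\underline{\ast}(y\overline{\ast}z)$. $\mathcal{Q}(X)$ is the quandle with underlying set $X$ and $x\ast y:=(x\,\underline{\ast}\,y)\,\overline{\ast}^{-1}y$. Diagrams: every strand of an oriented link diagram $D\subset\mathbb{R}^2$ has a normal vector, obtained by rotating its direction counterclockwise by $90^\circ$. $\mathcal{A}(D)$: arcs (cut at under-crossings). $\mathcal{SA}(D)$: semi-arcs (cut over- and under-strands at all crossings). The specified region of a semi-arc $\sigma$ is the region $\rho_\sigma$ adjacent to $\sigma$ from which the normal of $\sigma$ points to the other side; the specified region of a crossing is the one from which both normals point away. A quandle coloring by $Q$ is a map $\mathcal{C}:\mathcal{A}(D)\to Q$ with $\mathcal{C}(\alpha_i)\ast\mathcal{C}(\alpha_j)=\mathcal{C}(\alpha_k)$ at each crossing, where $\alpha_j$ is the over-arc, whose normal points from the side of the under-arc $\alpha_i$ to that of the under-arc $\alpha_k$. A biquandle coloring by $X$ is a map $\mathcal{C}:\mathcal{SA}(D)\to X$ with $\mathcal{C}(\sigma_i)\,\underline{\ast}\,\mathcal{C}(\sigma_j)=\mathcal{C}(\sigma_k)$ and $\mathcal{C}(\sigma_j)\,\overline{\ast}\,\mathcal{C}(\sigma_i)=\mathcal{C}(\sigma_l)$ at each crossing, where $\sigma_i$ (under), $\sigma_j$ (over) are adjacent to the specified region and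 $\sigma_k$ (under), $\sigma_l$ (over) are the other two semi-arcs. $\mathrm{Col}_Q(D)$, $\mathrm{Col}_X(D)$ are the sets of colorings. Shadow colorings: for a quandle $Q$, $\mathrm{As}(Q)=\langle a\ (a\in Q)\mid a\cdot b=b\cdot(a\ast b)\rangle$. For $\mathcal{C}\in\mathrm{Col}_Q(D)$, the region coloring $\mathcal{C}^R$ is the unique map from the set of regions to $\mathrm{As}(Q)$ sending the unbounded region to $e$ and satisfying $\mathcal{C}^R(R_1)\cdot\mathcal{C}(\sigma)=\mathcal{C}^R(R_2)$ whenever the normal of the semi-arc $\sigma$ points from $R_1$ to $R_2$ (the color of a semi-arc is that of its arc). The shadow coloring is $\mathcal{C}^S:\mathcal{SA}(D)\to\mathrm{As}(Q)\times Q$, $\mathcal{C}^S(\sigma)=(\mathcal{C}^R(\rho_\sigma),\mathcal{C}(\sigma))$. The map $\psi$: let $k:X\to X$ be the unique bijection with $k(x)\,\overline{\ast}\,k(x)=x$. Then $\psi:\mathrm{As}(\mathcal{Q}(X))\times\mathcal{Q}(X)\to X$ is the (well-defined) map given inductively by $\psi(e,a)=a$, $\psi(p\cdot b,a)=\psi(p,a)\,\overline{\ast}\,\psi(p,b)$, $\psi(p\cdot b^{-1},a)=\psi(p,a)\,\overline{\ast}^{-1}k(\psi(p,b))$. The bijection $\Psi:\mathrm{Col}_{\mathcal{Q}(X)}(D)\to\mathrm{Col}_X(D)$ is given by $\Psi(\mathcal{C})=\psi\circ\mathcal{C}^S$ (it is constructed diagrammatically in the paper and coincides with this formula). Biquandle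 2-cocycle: $\theta:X^2\to A$ with $\theta(y,y)=0$ and, for all $x_1,x_2,x_3\in X$, $[\theta(x_2,x_3)-\theta(x_2\overline{\ast}x_1,x_3\overline{\ast}x_1)]-[\theta(x_1,x_3)-\theta(x_1\underline{\ast}x_2,x_3\overline{\ast}x_2)]+[\theta(x_1,x_2)-\theta(x_1\underline{\ast}x_3,x_2\underline{\ast}x_3)]=0$. Biquandle cocycle invariant: for $\mathcal{C}\in\mathrm{Col}_X(D)$, $(\Phi_\theta(D))(\mathcal{C})\in A$ is the sum over all crossings of $\varepsilon\,\theta(x,y)$, where $\varepsilon=\pm1$ is the sign of the crossing and $x$, $y$ are the colors of the under- and over-semi-arcs adjacent to the specified region of the crossing. When $X$ is finite, $\Phi_\theta(D)$ also denotes $\sum_{\mathcal{C}\in\mathrm{Col}_X(D)}(\Phi_\theta(D))(\mathcal{C})\in\mathbb{Z}[A]$ (formal sum of group elements). Shadow quandle 2-cocycle: $\theta':\mathrm{As}(Q)\times Q^2\to A$ with $\theta'(p,b,b)=0$ and, for all $p,a_1,a_2,a_3$, $[\theta'(p,a_2,a_3)-\theta'(p\cdot a_1,a_2,a_3)]-[\theta'(p,a_1,a_3)-\theta'(p\cdot a_2,a_1\ast a_2,a_3)]+[\theta'(p,a_1,a_2)-\theta'(p\cdot a_3,a_1\ast a_3,a_2\ast a_3)]=0$. Shadow quandle cocycle invariant: for $\mathcal{C}\in\mathrm{Col}_Q(D)$, $(\Phi^S_{\theta'}(D))(\mathcal{C})\in A$ is the sum over all crossings of $\varepsilon\,\theta'(p,a,b)$,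 where $\varepsilon$ is the sign of the crossing, $p$ is the region color of the specified region of the crossing, $a$ the color of the under-arc adjacent to it, and $b$ the color of the over-arc. When $Q$ is finite, $\Phi^S_{\theta'}(D)$ also denotes $\sum_{\mathcal{C}\in\mathrm{Col}_Q(D)}(\Phi^S_{\theta'}(D))(\mathcal{C})\in\mathbb{Z}[A]$. Pullback: $(\psi^*\theta)(p,a_1,a_2):=\theta(\psi(p,a_1),\psi(p,a_2))$, a shadow quandle 2-cocycle of $\mathcal{Q}(X)$. *)

(* Defs.v *)
From HB Require Import structures.
From mathcomp Require Import all_boot all_order perm all_algebra.
From mathcomp Require Import all_classical.
From mathcomp.multinomials Require Import freeg.

Set Implicit Arguments.
Unset Strict Implicit.
Unset Printing Implicit Defensive.

Import GRing.Theory.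

Local Open Scope ring_scope.
Local Open Scope classical_set_scope.
Local Open Scope quotient_scope.

Reserved Notation "x *q y" (at level 40, left associativity).
Reserved Notation "x *u y" (at level 40, left associativity).
Reserved Notation "x *o y" (at level 40, left associativity).
Reserved Notation "x /o y" (at level 40, left associativity).

HB.mixin Record isQuandle Q := {
  qop : Q -> Q -> Q;
  qop_idem : forall a, qop a a = a;
  qop_bij : forall a, bijective (qop^~ a);
  qop_dist : forall a b c, qop (qop a b) c = qop (qop a c) (qop b c)
}.

#[short(type="quandleType")]
HB.structure Definition Quandle := {Q of isQuandle Q & Choice Q}.

Notation "x *q y" := (qop x y).

(* [bun] and [bov] are the underlined and the overlined operation. *)
HB.mixin Record isBiquandle X := {
  bun : X -> X -> X;
  bov : X -> X -> X;
  bq_diag : forall x, bun x x = bov x x;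
  bun_bij : forall x, bijective (bun^~ x);
  bov_bij : forall x, bijective (bov^~ x);
  bq_switch_bij : bijective (fun xy : X * X => (bov xy.2 xy.1, bun xy.1 xy.2));
  bq_unun : forall x y z,
    bun (bun x y) (bun z y) = bun (bun x z) (bov y z);
  bq_ovov : forall x y z,
    bov (bov x y) (bov z y) = bov (bov x z) (bun y z);
  bq_unov : forall x y z,
    bov (bun x y) (bun z y) = bun (bov x z) (bov y z)
}.

#[short(type="biquandleType")]
HB.structure Definition Biquandle := {X of isBiquandle X & Choice X}.

Notation "x *u y" := (bun x y).
Notation "x *o y" := (bov x y).

(* The inverse of [fun z => z *o y], and the map k with k x *o k x = x; both
   are characterized by the lemmas [bovKV], [bovK], [bkP] and [bkK] below. *)
Definition bovV (X : biquandleType) (x y : X) : X :=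
  xget x [set z | z *o y = x].
Notation "x /o y" := (bovV x y).

Definition bk (X : biquandleType) (x : X) : X := xget x [set y | y *o y = x].

Section BiquandleTheory.
Variable X : biquandleType.
Implicit Types x y z d : X.

Lemma bov_inj y : injective (fun x => x *o y).
Proof. exact: bij_inj (bov_bij y). Qed.

Lemma bun_inj y : injective (fun x => x *u y).
Proof. exact: bij_inj (bun_bij y). Qed.

Lemma bovKV y x : (x /o y) *o y = x.
Proof.
rewrite /bovV; have [g _ gK] := bov_bij y.
by apply: (xgetPex x (P := [set z | z *o y = x])); exists (g x); apply: gK.
Qed.

Lemma bovK y x : (x *o y) /o y = x.
Proof. by apply: (@bov_inj y); rewrite bovKV. Qed.

Lemma bk_ex x : exists y, y *o y = x.
Proof.
have [g _ gK] := @bq_switch_bij X.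
case E: (g (x, x)) => [a b]; have := gK (x, x); rewrite E /= => -[e1 e2].
exists a; rewrite -bq_diag; apply: (@bun_inj x).
have := bq_unun a b a; rewrite e2 e1 => <-.
by [].
Qed.

Lemma bkP x : bk x *o bk x = x.
Proof. exact: (xgetPex x (P := [set y | y *o y = x]) (bk_ex x)). Qed.

Lemma bsq_inj : injective (fun x => x *o x).
Proof.
move=> x y /= e; have := bij_inj (@bq_switch_bij X) (x1 := (x, x)) (x2 := (y, y)).
by rewrite /= !bq_diag e => /(_ erefl) [].
Qed.

Lemma bkK x : bk (x *o x) = x.
Proof. by apply: bsq_inj; rewrite /= bkP. Qed.

End BiquandleTheory.

Definition quandle_of (X : biquandleType) : Type := X.

Definition quandle_of_op (X : biquandleType) (x y : X) : X := (x *u y) /o y.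

Section QuandleOf.
Variable X : biquandleType.
Notation op := (@quandle_of_op X).

Lemma quandle_of_opE (x y : X) : op x y *o y = x *u y.
Proof. exact: bovKV. Qed.

Lemma quandle_of_op_bov (d x y : X) : op x y *o d = op (x *o d) (y *o d).
Proof.
apply: (@bov_inj _ (y *o d)).
by rewrite quandle_of_opE bq_ovov quandle_of_opE bq_unov.
Qed.

Lemma quandle_of_op_bovV (d x y : X) : op x y /o d = op (x /o d) (y /o d).
Proof. by apply: (@bov_inj _ d); rewrite quandle_of_op_bov !bovKV. Qed.

Lemma quandle_of_op_bun (d x y : X) : op x y *u d = op (x *u d) (y *u d).
Proof.
apply: (@bov_inj _ (y *u d)).
by rewrite quandle_of_opE bq_unov quandle_of_opE bq_unun.
Qed.

Lemma quandle_of_idem (x : X) : op x x = x.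
Proof. by rewrite /quandle_of_op bq_diag bovK. Qed.

Lemma quandle_of_bij (y : X) : bijective (op^~ y).
Proof.
have [g gK Kg] := bun_bij y; exists (fun x => g (x *o y)) => x /=.
  by rewrite quandle_of_opE gK.
by apply: (@bov_inj _ y); rewrite quandle_of_opE; apply: Kg.
Qed.

Lemma quandle_of_dist (x y z : X) : op (op x y) z = op (op x z) (op y z).
Proof.
by rewrite {1}/quandle_of_op quandle_of_op_bun quandle_of_op_bovV.
Qed.

HB.instance Definition _ := Choice.on (quandle_of X).
HB.instance Definition _ := isQuandle.Build (quandle_of X)
  quandle_of_idem quandle_of_bij quandle_of_dist.

End QuandleOf.

(* A word in the generators and their inverses: (a, true) stands for a and
   (a, false) for a^-1. *)
Definition as_word (Q : quandleType) := seq (Q * bool).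

Inductive as_rel (Q : quandleType) : as_word Q -> as_word Q -> Prop :=
| as_refl u : as_rel u u
| as_sym u v : as_rel u v -> as_rel v u
| as_trans v u w : as_rel u v -> as_rel v w -> as_rel u w
| as_cat u u' v v' : as_rel u u' -> as_rel v v' -> as_rel (u ++ v) (u' ++ v')
| as_cancel a b : as_rel [:: (a, b); (a, ~~ b)] [::]
| as_comm a b : as_rel [:: (a, true); (b, true)] [:: (b, true); (a *q b, true)].

Section AssociatedGroup.
Variable Q : quandleType.

Definition as_equiv (u v : as_word Q) : bool := `[< as_rel u v >].

Lemma as_equiv_refl : reflexive as_equiv.
Proof. by move=> u; apply/asboolP; apply: as_refl. Qed.

Lemma as_equiv_sym : symmetric as_equiv.
Proof. by move=> u v; apply/asboolP/asboolP; apply: as_sym. Qed.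

Lemma as_equiv_trans : transitive as_equiv.
Proof.
by move=> v u w /asboolP uv /asboolP vw; apply/asboolP; apply: as_trans uv vw.
Qed.

Canonical as_equiv_rel :=
  EquivRel as_equiv as_equiv_refl as_equiv_sym as_equiv_trans.

Definition As : Type := {eq_quot as_equiv_rel}.

HB.instance Definition _ := Choice.on As.

Definition as_class (u : as_word Q) : As := \pi_({eq_quot as_equiv_rel}) u.
Definition as_repr (p : As) : as_word Q :=
  repr (p : {eq_quot as_equiv_rel}).

Lemma as_classP u v : as_class u = as_class v <-> as_rel u v.
Proof.
by split=> [/eqmodP/asboolP|uv] //; apply/eqmodP/asboolP.
Qed.

Lemma as_reprK p : as_class (as_repr p) = p.
Proof. exact: reprK. Qed.

Lemma as_repr_class u : as_rel (as_repr (as_class u)) u.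
Proof. by apply/as_classP; rewrite as_reprK. Qed.

Definition as_word_inv (u : as_word Q) : as_word Q :=
  rev [seq (x.1, ~~ x.2) | x <- u].

Definition as_one : As := as_class [::].
Definition as_mul (p q : As) : As := as_class (as_repr p ++ as_repr q).
Definition as_inv (p : As) : As := as_class (as_word_inv (as_repr p)).

Lemma as_class_cat u v : as_class (u ++ v) = as_mul (as_class u) (as_class v).
Proof. by apply/as_classP; apply: as_cat; apply: as_sym; apply: as_repr_class. Qed.

Lemma as_word_invr u : as_rel (u ++ as_word_inv u) [::].
Proof.
elim: u => [|[a b] u IHu]; first exact: as_refl.
rewrite /as_word_inv /= rev_cons -cats1 -/(as_word_inv u) catA.
apply: (@as_trans _ ([:: (a, b)] ++ [::] ++ [:: (a, ~~ b)])); last first.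
  exact: as_cancel.
apply: (@as_cat _ [:: (a, b)] [:: (a, b)]); first exact: as_refl.
by apply: as_cat => //; apply: as_refl.
Qed.

Lemma as_word_invK : involutive as_word_inv.
Proof.
move=> u; rewrite /as_word_inv map_rev revK -map_comp -[RHS]map_id.
by apply: eq_map => -[a b] /=; rewrite negbK.
Qed.

Lemma as_word_invl u : as_rel (as_word_inv u ++ u) [::].
Proof. by rewrite -{2}[u]as_word_invK; apply: as_word_invr. Qed.

Lemma as_mulA : associative as_mul.
Proof.
move=> p q r; rewrite -[p]as_reprK -[q]as_reprK -[r]as_reprK.
by rewrite -!as_class_cat catA.
Qed.

Lemma as_mul1 : left_id as_one as_mul.
Proof. by move=> p; rewrite -[p]as_reprK -as_class_cat. Qed.

Lemma as_mulr1 : right_id as_one as_mul.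
Proof. by move=> p; rewrite -[p]as_reprK -as_class_cat cats0. Qed.

Lemma as_mulV : left_inverse as_one as_inv as_mul.
Proof.
move=> p; rewrite -{2}[p]as_reprK -as_class_cat; apply/as_classP.
exact: as_word_invl.
Qed.

Lemma as_mulrV : right_inverse as_one as_inv as_mul.
Proof.
move=> p; rewrite -{1}[p]as_reprK -as_class_cat; apply/as_classP.
exact: as_word_invr.
Qed.

HB.instance Definition _ := isGroup.Build As
  as_mulA as_mul1 as_mulr1 as_mulV as_mulrV.

Definition as_gen (a : Q) : As := as_class [:: (a, true)].

Lemma as_genV (a : Q) : ((as_gen a)^-1)%g = as_class [:: (a, false)].
Proof.
apply: (mulgI (as_gen a)); rewrite mulgV; apply: esym.
by rewrite -[LHS]as_class_cat; apply/as_classP; apply: as_cancel.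
Qed.

Lemma as_gen_comm (a b : Q) :
  (as_gen a * as_gen b = as_gen b * as_gen (a *q b))%g.
Proof.
rewrite -[LHS]as_class_cat -[RHS]as_class_cat.
by apply/as_classP; apply: as_comm.
Qed.

End AssociatedGroup.

Section Psi.
Variable X : biquandleType.

Definition psi_step (f : X -> X) (b : quandle_of X * bool) : X -> X :=
  fun a => if b.2 then f a *o f b.1 else f a /o bk (f b.1).

Definition psi_word (f : X -> X) (w : as_word (quandle_of X)) : X -> X :=
  foldl psi_step f w.

Definition psi (p : As (quandle_of X)) (a : quandle_of X) : X :=
  psi_word id (as_repr p) a.

Definition psi_hom (f : X -> X) :=
  forall a b, f (quandle_of_op a b) = quandle_of_op (f a) (f b).

Lemma psi_step_hom f b : psi_hom f -> psi_hom (psi_step f b).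
Proof.
rewrite /psi_step => fH x y; case: ifP => _; rewrite fH.
  exact: quandle_of_op_bov.
exact: quandle_of_op_bovV.
Qed.

Lemma psi_word_hom f w : psi_hom f -> psi_hom (psi_word f w).
Proof. by elim: w f => //= b w IHw f fH; apply/IHw/psi_step_hom. Qed.

Lemma psi_word_rel u v : as_rel u v ->
  forall f, psi_hom f -> psi_word f u = psi_word f v.
Proof.
elim=> {u v} [u|u v _ IH|v u w _ IH1 _ IH2|u u' v v' _ IH1 _ IH2|a b|a b] f fH.
- by [].
- by rewrite IH.
- by rewrite IH1 // IH2.
- rewrite /psi_word !foldl_cat -/(psi_word _ u) -/(psi_word _ u') IH1 //.
  by apply: IH2; apply: psi_word_hom.
- apply/funext => x; case: b; rewrite /psi_word /= /psi_step /=.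
    by rewrite bkK bovK.
  set k := bk (f a).
  suff -> : f a /o k = k by rewrite bovKV.
  by apply: (@bov_inj _ k); rewrite bovKV bkP.
- apply/funext => x; rewrite /psi_word /= /psi_step /= bq_ovov.
  by rewrite fH quandle_of_opE.
Qed.

Lemma psi_class w a : psi (as_class w) a = psi_word id w a.
Proof. by rewrite /psi (psi_word_rel (as_repr_class w)). Qed.

Lemma psi1 a : psi 1%g a = a.
Proof. exact: psi_class. Qed.

Lemma psi_gen p b a : psi (p * as_gen b)%g a = psi p a *o psi p b.
Proof.
by rewrite -{1}[p]as_reprK -[X in psi X]as_class_cat psi_class /psi_word foldl_cat.
Qed.

Lemma psi_genV p b a : psi (p * (as_gen b)^-1)%g a = psi p a /o bk (psi p b).
Proof.
rewrite -{1}[p]as_reprK as_genV -[X in psi X]as_class_cat psi_class.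
by rewrite /psi_word foldl_cat.
Qed.

Lemma psi_op p (a b : quandle_of X) :
  psi p (a *q b) *o psi p b = psi p a *u psi p b.
Proof.
have -> : psi p (a *q b) = quandle_of_op (psi p a) (psi p b).
  exact: psi_word_hom.
exact: quandle_of_opE.
Qed.

End Psi.

(* Both kinds of cocycle are 2-cocycles. *)
Record bq_cocycle (X : biquandleType) (A : zmodType) := BqCocycle {
  bq_cocycle_fun :> X -> X -> A;
  _ : forall y, bq_cocycle_fun y y = 0;
  _ : forall x1 x2 x3, let theta := bq_cocycle_fun in
    (theta x2 x3 - theta (x2 *o x1) (x3 *o x1))
    - (theta x1 x3 - theta (x1 *u x2) (x3 *o x2))
    + (theta x1 x2 - theta (x1 *u x3) (x2 *u x3)) = 0
}.

Record shadow_cocycle (Q : quandleType) (A : zmodType) := ShadowCocycle {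
  shadow_cocycle_fun :> As Q -> Q -> Q -> A;
  _ : forall p b, shadow_cocycle_fun p b b = 0;
  _ : forall p a1 a2 a3, let theta := shadow_cocycle_fun in
    (theta p a2 a3 - theta (p * as_gen a1)%g a2 a3)
    - (theta p a1 a3 - theta (p * as_gen a2)%g (a1 *q a2) a3)
    + (theta p a1 a2 - theta (p * as_gen a3)%g (a1 *q a3) (a2 *q a3)) = 0
}.

Section Pullback.
Variables (X : biquandleType) (A : zmodType) (theta : bq_cocycle X A).

Definition pullback_fun (p : As (quandle_of X)) (a1 a2 : quandle_of X) : A :=
  theta (psi p a1) (psi p a2).

Lemma pullback_diag p b : pullback_fun p b b = 0.
Proof. by rewrite /pullback_fun; case: theta. Qed.

Lemma pullback_rel p a1 a2 a3 : let theta' := pullback_fun in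
  (theta' p a2 a3 - theta' (p * as_gen a1)%g a2 a3)
  - (theta' p a1 a3 - theta' (p * as_gen a2)%g (a1 *q a2) a3)
  + (theta' p a1 a2 - theta' (p * as_gen a3)%g (a1 *q a3) (a2 *q a3)) = 0.
Proof. by rewrite /= /pullback_fun !psi_gen !psi_op; case: theta => ? ? /= ->. Qed.

Definition pullback : shadow_cocycle (quandle_of X) A :=
  ShadowCocycle pullback_diag pullback_rel.

End Pullback.

(* An oriented link diagram, up to isotopy of the plane, is given by its
   crossings, the way they are joined, and its regions.

   Every crossing c has an under-strand (c, false) and an over-strand
   (c, true).  Following the orientation, the semi-arc that leaves c along the
   strand s arrives at the crossing c' along the strand s', where
   (c', s') = glue (c, s).  The remaining semi-arcs are the components without
   crossings ([circle]). *)

Record link_code := LinkCode {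
  crossing : finType;
  circle : finType;
  positive : crossing -> bool;
  glue : {perm crossing * bool}
}.

Section Code.
Variable G : link_code.

Definition semiarc : finType := (crossing G * bool + circle G)%type.

Definition outgoing (c : crossing G) (s : bool) : semiarc := inl (c, s).
Definition incoming (c : crossing G) (s : bool) : semiarc :=
  inl ((glue G)^-1%g (c, s)).

Definition crossing_sign (c : crossing G) : int :=
  if positive c then 1 else -1.

(* The normal of a strand is its direction rotated counterclockwise, so it
   points from right to left.  The specified region of a crossing is the one to
   the right of both strands: at a positive crossing it lies between the incoming
   under-semi-arc and the outgoing over-semi-arc, at a negative one between the
   outgoing under-semi-arc and the incoming over-semi-arc.

     positive:  over  SW -> NE        negative:  over  SE -> NW
                under SE -> NW                   under SW -> NE

   (specified region to the east in both pictures).  The suffix [spec] refers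
   to the semi-arcs adjacent to the specified region, [opp] to the others. *)
Definition under_spec c :=
  if positive c then incoming c false else outgoing c false.
Definition under_opp c :=
  if positive c then outgoing c false else incoming c false.
Definition over_spec c :=
  if positive c then outgoing c true else incoming c true.
Definition over_opp c :=
  if positive c then incoming c true else outgoing c true.

Definition joined (c d : crossing G) : bool :=
  [exists s, (glue G (c, s)).1 == d] || [exists s, (glue G (d, s)).1 == c].

(* The number of connected components of the diagram as a subset of the
   plane. *)
Definition num_components : nat := n_comp joined predT + #|circle G|.

Definition passes_over (s t : semiarc) : bool :=
  [exists c, (s == incoming c true) && (t == outgoing c true)].

Definition same_arc : rel semiarc :=
  connect [rel s t | passes_over s t || passes_over t s].

Definition is_arc (B : {set semiarc}) : bool :=
  [exists s, B == [set t | same_arc s t]%SET].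

(* An arc is represented by the set of the semi-arcs it consists of. *)
Definition arc : finType := {B : {set semiarc} | is_arc B}.

Lemma is_arc_class s : is_arc [set t | same_arc s t]%SET.
Proof. by apply/existsP; exists s. Qed.

Definition arc_of (s : semiarc) : arc := Sub _ (is_arc_class s).

End Code.

(* Each of the four corners of a crossing lies in one region; this gives the
   four [corner] equations.  The last two conditions say that the surface
   carrying the diagram is a plane (equivalently, a sphere with a chosen
   region): its regions are connected to each other across semi-arcs, and
   Euler's formula V + F = E + 1 + C for a plane graph with C components holds.
   Here V is the number of crossings, E = 2V, and the circles are left out of V
   and E since each of them would contribute one edge and one base point.
   Regions are not assumed to be discs: a split diagram has regions with
   several boundary cycles. *)
Record diagram := Diagram {
  diagram_code :> link_code;
  region : finType;
  unbounded : region;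
  left_region : semiarc diagram_code -> region;
  right_region : semiarc diagram_code -> region;
  corner_spec : forall c : crossing diagram_code,
    right_region (under_spec c) = right_region (over_spec c);
  corner_over : forall c : crossing diagram_code,
    left_region (over_spec c) = right_region (under_opp c);
  corner_under : forall c : crossing diagram_code,
    left_region (under_spec c) = right_region (over_opp c);
  corner_opp : forall c : crossing diagram_code,
    left_region (under_opp c) = left_region (over_opp c);
  region_connected : forall r, connect
    [rel r1 r2 | [exists s, ((left_region s == r1) && (right_region s == r2))
                         || ((left_region s == r2) && (right_region s == r1))]]
    unbounded r;
  euler : (#|crossing diagram_code| + #|region| =
    #|{: crossing diagram_code * bool}| + 1 + num_components diagram_code)%N
}.

Arguments left_region [d] _.
Arguments right_region [d] _.

(* The element of Z[A] given by a; only the additive structure of the group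
   ring Z[A] is needed. *)
Definition formal (A : zmodType) (a : A) : {freeg A / int} :=
  << (1 : int) *g a >>.

Section Colorings.
Variable D : diagram.

Definition spec_region_crossing (c : crossing D) : region D :=
  right_region (under_spec c).

Definition qnd_coloring (Q : quandleType) : set {ffun arc D -> Q} :=
  [set C | forall c : crossing D,
     C (arc_of (under_spec c)) *q C (arc_of (over_spec c))
     = C (arc_of (under_opp c))].

Definition bq_coloring (X : biquandleType) : set {ffun semiarc D -> X} :=
  [set C | forall c : crossing D,
     C (under_spec c) *u C (over_spec c) = C (under_opp c) /\
     C (over_spec c) *o C (under_spec c) = C (over_opp c)].

Definition is_region_coloring (Q : quandleType) (C : {ffun arc D -> Q})
    (CR : {ffun region D -> As Q}) : Prop :=
  CR (unbounded D) = 1%g /\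
  forall s : semiarc D,
    (CR (right_region s) * as_gen (C (arc_of s)))%g = CR (left_region s).

(* For C in [qnd_coloring] there is exactly one region coloring, because the
   plane is simply connected and the region condition is consistent around each
   crossing by [as_gen_comm]; so the default value of [xget] is irrelevant. *)
Definition region_coloring (Q : quandleType) (C : {ffun arc D -> Q}) :
    {ffun region D -> As Q} :=
  xget [ffun => 1%g] [set CR | is_region_coloring C CR].

Definition shadow_coloring (Q : quandleType) (C : {ffun arc D -> Q})
    (s : semiarc D) : As Q * Q :=
  (region_coloring C (right_region s), C (arc_of s)).

Definition Psi (X : biquandleType) (C : {ffun arc D -> quandle_of X}) :
    {ffun semiarc D -> X} :=
  [ffun s => psi (shadow_coloring C s).1 (shadow_coloring C s).2].

Section Invariants.
Variable A : zmodType.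

Definition bq_weight (X : biquandleType) (theta : bq_cocycle X A)
    (C : {ffun semiarc D -> X}) : A :=
  \sum_(c : crossing D)
     theta (C (under_spec c)) (C (over_spec c)) *~ crossing_sign c.

Definition shadow_weight (Q : quandleType) (theta : shadow_cocycle Q A)
    (C : {ffun arc D -> Q}) : A :=
  \sum_(c : crossing D)
     theta (region_coloring C (spec_region_crossing c))
       (C (arc_of (under_spec c))) (C (arc_of (over_spec c)))
     *~ crossing_sign c.

(* The invariants in Z[A]; they are only meaningful for finite X and Q. *)
Definition bq_invariant (X : biquandleType) (theta : bq_cocycle X A) :
    {freeg A / int} :=
  \sum_(C \in @bq_coloring X) formal (bq_weight theta C).

Definition shadow_invariant (Q : quandleType) (theta : shadow_cocycle Q A) :
    {freeg A / int} :=
  \sum_(C \in @qnd_coloring Q) formal (shadow_weight theta C).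

End Invariants.
End Colorings.

(* Main.v *)
Require Import Defs.
From mathcomp Require Import all_boot all_order perm all_algebra.
From mathcomp Require Import all_classical.
From mathcomp.multinomials Require Import freeg.
From mathcomp Require Import zify.

Set Implicit Arguments.
Unset Strict Implicit.
Unset Printing Implicit Defensive.

(* Let p be the region color to the right of a semi-arc s.  As [psi p] is a
   bijection, the biquandle color psi(p, a) of s and p determine the quandle color
   a, hence also the region color p a to the left of s.  So both kinds of coloring
   determine for every semi-arc a bijection of As(Q(X)), carrying the region color
   on its right to the one on its left, and these bijections commute around every
   crossing.  Everything reduces to the fact that such a system of bijections is
   integrated by a unique map on the regions.

   That fact says that the complex with the regions as vertices, the semi-arcs as
   edges and the crossings as square faces is simply connected, which has to be
   extracted from Euler's formula.  Integrate along a spanning tree of the regions.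
   Modulo 2, a set of crossings whose boundary lies in the tree has no boundary;
   with Euler's formula, a counting argument then shows that every edge e outside
   the tree is the only such edge in the boundary of some set S of crossings.  By
   induction on #|S|, the other edges outside the tree at the end of e in S are
   integrated correctly, and the relation at that crossing forces e to be. *)

(** * Distances and recursion in a rooted graph *)

Section Ranking.
Variables (T : finType) (e : rel T) (x0 : T).
Hypothesis x0_connect : forall x, connect e x0 x.

(** The rank is the distance from [x0]; the last but one vertex of a shortest path is closer. *)
Lemma ranking_exists : exists rank : T -> nat, forall x, x != x0 ->
  exists2 y, e y x & (rank y < rank x)%N.
Proof.
pose step n x := [exists p : n.-tuple T, path e x0 p && (last x0 p == x)].
have stepE x : exists n, step n x.
  have /connectP[p pP ->] := x0_connect x; exists (size p).
  by apply/existsP; exists (in_tuple p); rewrite pP eqxx.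
exists (fun x => ex_minn (stepE x)) => x xx0.
case: (ex_minnP (stepE x)) => n /existsP[p /andP[pP /eqP xE]] n_min.
case: n p pP xE n_min => [|n] p pP xE n_min.
  by move: xx0; rewrite -xE tuple0 eqxx.
case/tupleP: p pP xE => y p' pP xE.
have [q [z qE]] : exists q z, y :: p' = rcons q z.
  by exists (belast y p'), (last y p'); rewrite lastI.
have sq : size q == n.
  by move: (congr1 size qE); rewrite /= size_rcons size_tuple => -[->].
move: pP xE; rewrite [tval _]qE rcons_path last_rcons => /andP[qP qz] zx.
exists (last x0 q); first by rewrite -zx.
case: ex_minnP => m _ /(_ n); apply; apply/existsP.
by exists (Tuple sq); rewrite qP eqxx.
Qed.

End Ranking.

Section RankRecursion.
Variables (T : eqType) (P : Type) (x0 : T) (p0 : P).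
Variables (rank : T -> nat) (parent : T -> T) (step : T -> P -> P).
Hypothesis parent_lt : forall x, x != x0 -> (rank (parent x) < rank x)%N.

Lemma rank_recursion : exists f : T -> P,
  f x0 = p0 /\ forall x, x != x0 -> f x = step x (f (parent x)).
Proof.
(* [n] is fuel: every [n] above the rank of [x] gives the same value, as the rank drops at each
   call. *)
pose F := fix F n x : P := if n is m.+1 then
  if x == x0 then p0 else step x (F m (parent x)) else p0.
have Findep n m x : (rank x < n)%N -> (rank x < m)%N -> F n x = F m x.
  elim: n m x => [|n IHn] [|m] x //= xn xm; case: eqVneq => // xx0.
  by rewrite (IHn m) //; have := parent_lt xx0; lia.
exists (fun x => F (rank x).+1 x); split=> [|x xx0] /=; first by rewrite eqxx.
rewrite (negPf xx0) -/F; congr (step x _).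
exact: Findep (parent_lt xx0) (ltnSn _).
Qed.

End RankRecursion.

(** * Cuts of the dual graph *)

Section DualGraph.
Variable D : diagram.
Implicit Types (S : {set crossing D}) (e : semiarc D) (r : region D).

(** Counted modulo 2: a semi-arc with the same region on both sides is incident to nothing. *)
Definition incident e r : bool := (left_region e == r) (+) (right_region e == r).

Definition boundary S e : bool :=
  if e is inl x then (x.1 \in S) (+) ((Defs.glue D x).1 \in S) else false.

Lemma boundaryC S e : boundary (~: S)%SET e = boundary S e.
Proof. by case: e => //= x; rewrite !inE; do 2!case: (_ \in S). Qed.

Lemma boundary_symdiff S S' e :
  boundary [set c | (c \in S) (+) (c \in S')]%SET e
  = boundary S e (+) boundary S' e.
Proof. by case: e => //= x; rewrite !inE addbACA. Qed.

(** Each corner of a crossing lies along two of its four semi-arc ends, so all incidences cancel. *)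
Lemma corner_incident (c : crossing D) r :
  incident (outgoing c false) r (+) incident (incoming c false) r
  = incident (outgoing c true) r (+) incident (incoming c true) r.
Proof.
rewrite /incident.
have := (corner_spec c, corner_over c, corner_under c, corner_opp c).
rewrite /under_spec /under_opp /over_spec /over_opp.
by case: (positive c) => -[[[-> ->] ->] ->]; do 4!case: (_ == r).
Qed.

(* [bd . bd = 0] modulo 2, for the complex with the regions as vertices and the
   crossings as faces. *)
Lemma boundary_incident S r :
  \big[addb/false]_(e : semiarc D) (boundary S e && incident e r) = false.
Proof.
rewrite big_sumType /= [X in _ (+) X]big1 // addbF.
under eq_bigr do rewrite andb_addl.
(* Arriving ends are regrouped by the crossing at which they arrive. *)
rewrite big_split /= [X in _ (+) X](reindex_inj (@perm_inj _ (Defs.glue D)^-1%g)) /=.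
under [X in _ (+) X]eq_bigr do rewrite permKV.
rewrite -big_split /=.
rewrite (eq_bigr (fun x => (x.1 \in S) && (incident (outgoing x.1 x.2) r (+)
  incident (incoming x.1 x.2) r))) => [|[c s] _]; last by rewrite -andb_addr.
rewrite -(pair_big predT predT (fun c s => (c \in S) &&
  (incident (outgoing c s) r (+) incident (incoming c s) r))) /=.
apply: big1 => c _.
by rewrite big_bool /= -andb_addr -corner_incident addbb andbF.
Qed.

Lemma boundary_joined S :
  (forall e, ~~ boundary S e) -> closed (@joined D) (mem S).
Proof.
move=> S0 c d; change (joined c d -> (c \in S) = (d \in S)).
have S0' x : (x.1 \in S) = ((Defs.glue D x).1 \in S).
  by have := S0 (inl x) => /=; do 2!case: (_ \in S).
by case/orP=> /existsP[s /eqP <-]; rewrite -S0'.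
Qed.

Lemma joined_connect_sym : connect_sym (@joined D).
Proof. by apply: sym_connect_sym => c d; rewrite /joined orbC. Qed.

Section SpanningTree.
Variables (rank : region D -> nat) (pe : region D -> semiarc D).

Definition other_region e r : region D :=
  if left_region e == r then right_region e else left_region e.

Hypothesis pe_end : forall r, r != unbounded D ->
  (left_region (pe r) == r) || (right_region (pe r) == r).
Hypothesis pe_lt : forall r, r != unbounded D ->
  (rank (other_region (pe r) r) < rank r)%N.

Definition tree : {set semiarc D} := (pe @: [set~ unbounded D])%SET.

Lemma pe_ends r : r != unbounded D ->
  (left_region (pe r) = r /\ (rank (right_region (pe r)) < rank r)%N) \/
  (right_region (pe r) = r /\ (rank (left_region (pe r)) < rank r)%N).
Proof.
move=> r0; have := pe_end r0; have := pe_lt r0; rewrite /other_region.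
by case: eqP => /= [|_] ? => [|/eqP]; [left | right].
Qed.

(** Two distinct regions sharing a parent edge would each have smaller rank than the other. *)
Lemma pe_inj : {in [set~ unbounded D]%SET &, injective pe}.
Proof.
move=> r r'; rewrite !inE => /pe_ends r1 /pe_ends r2 e.
by case: r1; case: r2; rewrite e => -[-> ?] [<- ?] //; exfalso; lia.
Qed.

Lemma card_tree : #|tree|.+1 = #|region D|.
Proof.
rewrite card_in_imset; last exact: pe_inj.
by rewrite cardsC1 prednK //; apply/card_gt0P; exists (unbounded D).
Qed.

(* A nonempty set of edges of a tree has a vertex of degree one: the child end
   of an edge whose child has maximal rank. *)
Lemma boundary_tree S :
  (forall e, boundary S e -> e \in tree) -> forall e, ~~ boundary S e.
Proof.
move=> St e; apply/negP=> Se.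
have /imsetP[r0 r0u eE] := St e Se.
pose Q r := (r != unbounded D) && boundary S (pe r).
have Q0 : Q r0 by rewrite /Q -eE Se andbT; move: r0u; rewrite !inE.
case: (arg_maxnP rank Q0) => r /andP[ru Sr] r_max.
have := boundary_incident S r; rewrite (bigD1 (pe r)) //= Sr /=.
(* Another boundary edge at [r] would have [r] as its parent end, hence a child of larger rank. *)
rewrite big1 => [|e' e'r]; last first.
  apply/negbTE/negP=> /andP[Se' ir].
  have /imsetP[r' r'u e'E] := St e' Se'.
  have r'u' : r' != unbounded D by move: r'u; rewrite !inE.
  have := r_max r'; rewrite /Q r'u' -e'E Se' => /(_ isT) le_r'r.
  have r'r : r' != r by apply: contra_neq e'r => <-.
  move: ir; rewrite /incident; have := pe_ends r'u'; rewrite -e'E.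
  by case=> -[-> lt_r']; rewrite (negPf r'r) ?addbF /= => /eqP rE;
    move: lt_r'; rewrite rE; lia.
have := pe_ends ru; rewrite /incident addbF.
by case=> -[-> lt_r]; rewrite eqxx; case: eqP => // rE; move: lt_r; rewrite rE ltnn.
Qed.

(* Euler's formula makes the injection [S |-> boundary S \ tree], on the sets of
   crossings without component representatives, a bijection. *)
Lemma cotree_cut e : e \notin tree ->
  exists S, forall e', e' \notin tree -> boundary S e' = (e' == e).
Proof.
move=> et.
pose roots_set : {set crossing D} := [set c | roots (@joined D) c]%SET.
pose h S := [set e' | boundary S e' && (e' \notin tree)]%SET.
have h_inj : {in powerset (~: roots_set)%SET &, injective h}.
  move=> S S'; rewrite !powersetE => Sr S'r hSS'.
  pose U := [set c | (c \in S) (+) (c \in S')]%SET.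
  have U0 : closed (@joined D) (mem U).
    apply/boundary_joined/boundary_tree => e'; rewrite boundary_symdiff.
    move/setP/(_ e'): hSS'; rewrite !inE.
    by case: (e' \in tree) => //; rewrite !andbT => ->; rewrite addbb.
  (* If [U] contained [c], it would contain the root of its component, which [S] and [S'] both
     avoid. *)
  apply/setP=> c; apply/eqP; rewrite -negb_add; apply/negP=> cU.
  have : c \in U by rewrite inE.
  rewrite (closed_connect U0 (connect_root _ c)) inE.
  set d := fingraph.root _ _.
  have dr : d \in roots_set by rewrite inE; apply: roots_root joined_connect_sym _.
  have dN (V : {set crossing D}) : V \subset (~: roots_set)%SET -> d \in V = false.
    by move=> /fintype.subsetP Vr; apply/negP=> /Vr; rewrite inE dr.
  by rewrite !dN.
have hT : (h @: powerset (~: roots_set) \subset powerset (~: tree))%SET.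
  apply/fintype.subsetP=> _ /imsetP[S _ ->]; rewrite powersetE.
  by apply/fintype.subsetP=> e'; rewrite !inE => /andP[].
have hE : (h @: powerset (~: roots_set) == powerset (~: tree))%SET.
  (* By Euler's formula there are as many non-root crossings as edges outside the tree. *)
  rewrite eqEcard hT card_in_imset // !card_powerset leq_exp2l //.
  have card_roots : #|roots_set| = n_comp (@joined D) predT.
    by rewrite cardsE; apply: eq_card => c; rewrite !inE andbT.
  have := cardsC roots_set; have := cardsC tree; have := card_tree.
  have := euler D; rewrite /num_components -card_roots.
  by rewrite card_sum !card_prod card_bool; lia.
have : [set e]%SET \in powerset (~: tree)%SET.
  by rewrite powersetE finset.sub1set inE.
rewrite -(eqP hE) => /imsetP[S _ hS]; exists S => e' e't.
by move/setP/(_ e'): hS; rewrite !inE e't andbT.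
Qed.

End SpanningTree.
End DualGraph.

(** * Integrating bijections over the regions *)

Section Transport.
Variables (D : diagram) (P : Type) (p0 : P) (sigma tau : semiarc D -> P -> P).
Hypothesis sigmaK : forall e, cancel (sigma e) (tau e).
Hypothesis tauK : forall e, cancel (tau e) (sigma e).

(** Agreement spreads along paths from the unbounded region, in either direction across an edge
    since [sigma e] is injective. *)
Lemma region_map_unique (f g : region D -> P) :
    f (unbounded D) = g (unbounded D) ->
    (forall e, sigma e (f (right_region e)) = f (left_region e)) ->
    (forall e, sigma e (g (right_region e)) = g (left_region e)) ->
  f =1 g.
Proof.
move=> fg0 fs gs r; have /connectP[p pP ->] := region_connected r.
elim: p (unbounded D) fg0 pP => //= r1 p IHp r0 fg0 /andP[/existsP[e r0e]].
apply: IHp; case/orP: r0e => /andP[/eqP le /eqP re].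
  by apply: (can_inj (sigmaK e)); rewrite -re fs gs le.
by rewrite -le -fs -gs re fg0.
Qed.

Hypothesis sigma_crossing : forall (c : crossing D) p,
  sigma (over_opp c) (sigma (under_spec c) p)
  = sigma (under_opp c) (sigma (over_spec c) p).

Section Consistency.
Variable f : region D -> P.

Definition consistent e := sigma e (f (right_region e)) = f (left_region e).

Let corners (c : crossing D) :=
  (corner_spec c, corner_over c, corner_under c, corner_opp c).

(** Here and in the next three lemmas: in a commuting square of bijections, three consistent sides
    force the fourth. *)
Lemma consistent_under_spec c : consistent (over_opp c) ->
  consistent (under_opp c) -> consistent (over_spec c) ->
  consistent (under_spec c).
Proof.
rewrite /consistent => ov' un' ov; apply: (can_inj (sigmaK (over_opp c))).
have [[[cs co] cu] cp] := corners c.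
by rewrite sigma_crossing cu ov' -cp -un' -co -ov cs.
Qed.

Lemma consistent_over_spec c : consistent (over_opp c) ->
  consistent (under_opp c) -> consistent (under_spec c) ->
  consistent (over_spec c).
Proof.
rewrite /consistent => ov' un' un; apply: (can_inj (sigmaK (under_opp c))).
have [[[cs co] cu] cp] := corners c.
by rewrite -sigma_crossing co un' cp -ov' -cu -un cs.
Qed.

Lemma consistent_under_opp c : consistent (over_opp c) ->
  consistent (over_spec c) -> consistent (under_spec c) ->
  consistent (under_opp c).
Proof.
rewrite /consistent => ov' ov un; have [[[cs co] cu] cp] := corners c.
by rewrite -co -ov -cs -sigma_crossing un cu ov' cp.
Qed.

Lemma consistent_over_opp c : consistent (under_opp c) ->
  consistent (over_spec c) -> consistent (under_spec c) ->
  consistent (over_opp c).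
Proof.
rewrite /consistent => un' ov un; have [[[cs co] cu] cp] := corners c.
by rewrite -cu -un sigma_crossing cs ov co un' cp.
Qed.

Lemma consistent_outgoing c s : (forall s', consistent (incoming c s')) ->
  consistent (outgoing c (~~ s)) -> consistent (outgoing c s).
Proof.
move=> in_ok; have := (in_ok true, in_ok false); move=> {in_ok}.
have := (@consistent_under_spec c, @consistent_over_spec c,
         @consistent_under_opp c, @consistent_over_opp c).
rewrite /under_spec /under_opp /over_spec /over_opp.
by case: (positive c); case: s => /=; tauto.
Qed.

Lemma consistent_incoming c s : (forall s', consistent (outgoing c s')) ->
  consistent (incoming c (~~ s)) -> consistent (incoming c s).
Proof.
move=> out_ok; have := (out_ok true, out_ok false); move=> {out_ok}.
have := (@consistent_under_spec c, @consistent_over_spec c,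
         @consistent_under_opp c, @consistent_over_opp c).
rewrite /under_spec /under_opp /over_spec /over_opp.
by case: (positive c); case: s => /=; tauto.
Qed.

(** The exclusive or rules out a loop at [c], which would be two sides of the square at once. *)
Lemma consistent_at (c : crossing D) x :
    (x.1 == c) (+) ((Defs.glue D x).1 == c) ->
    (forall y, y != x -> (y.1 == c) || ((Defs.glue D y).1 == c) ->
      consistent (inl y)) ->
  consistent (inl x).
Proof.
have [<-|xc] := eqVneq x.1 c => /=.
  case: x => c' s /= gx ok; apply: consistent_outgoing => [s'|]; apply: ok.
  - by apply: contraNneq gx => <-; rewrite permKV eqxx.
  - by rewrite permKV eqxx orbT.
  - by rewrite xpair_eqE eqxx; case: (s).
  - by rewrite eqxx.
rewrite -{3}[x](permK (Defs.glue D)); case E : (Defs.glue D x) => [c' s] /=.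
move=> /eqP c'c ok; subst c'; apply: consistent_incoming => [s'|]; apply: ok.
- by apply: contraNneq xc => <-.
- by rewrite eqxx.
- by rewrite -(inj_eq (@perm_inj _ (Defs.glue D))) permKV E xpair_eqE eqxx; case: (s).
- by rewrite permKV eqxx orbT.
Qed.

(* If [e] is the only cotree edge in the boundary of [S], and [e1] another cotree
   edge at the end [c] of [e] in [S], then [e1] is the only cotree edge in the
   boundary of the part of [S] which [e1] separates from [c]. *)
Lemma consistent_cotree (T : {set semiarc D}) :
    (forall e, e \in T -> consistent e) ->
    (forall e, e \notin T -> exists S, forall e', e' \notin T ->
      boundary S e' = (e' == e)) ->
  forall e, consistent e.
Proof.
move=> Tok cut.
suff main n (S : {set crossing D}) e : (#|S| < n)%N -> e \notin T ->
    (forall e', e' \notin T -> boundary S e' = (e' == e)) -> consistent e.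
  move=> e; have [/Tok //|eT] := boolP (e \in T).
  by have [S Se] := cut e eT; apply: (main #|S|.+1 S).
elim: n S e => // n IHn S e ltSn eT Se.
have := Se e eT; rewrite eqxx; case: e eT Se => //= x xT Sx Sxx.
pose c := if x.1 \in S then x.1 else (Defs.glue D x).1.
have cS : c \in S.
  by rewrite /c; move: Sxx; case: ifP.
have cx : (x.1 == c) (+) ((Defs.glue D x).1 == c).
  rewrite /c; move: Sxx; case: ifP => xS /=; rewrite eqxx ?addbT /=.
    by apply: contraNneq => ->.
  by move=> gS; apply/eqP => gx; move: xS; rewrite gx gS.
apply: (consistent_at cx) => y yx yc.
have [/Tok //|yT] := boolP (inl y \in T).
have yS : (y.1 \in S) = ((Defs.glue D y).1 \in S).
  apply/eqP; rewrite -negb_add; have := Sx _ yT => /= ->.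
  by apply/eqP => -[] yx'; rewrite yx' eqxx in yx.
(* A set and its complement have the same boundary, so the one avoiding [c] can be taken. *)
have [S1 cS1 S1y] : exists2 S1 : {set crossing D}, c \notin S1 &
    forall e', e' \notin T -> boundary S1 e' = (e' == inl y).
  have [S1 S1y] := cut _ yT; have [cS1|cS1] := boolP (c \in S1); last by exists S1.
  by exists (~: S1)%SET => [|e' e'T]; rewrite ?boundaryC ?S1y // inE cS1.
apply: (IHn (S :&: S1)%SET) => // [|e' e'T].
  rewrite ltnS in ltSn; apply: leq_trans ltSn; apply: proper_card; apply/properP.
  by split; [exact: finset.subsetIl | exists c => //; rewrite inE (negPf cS1) andbF].
(* Both ends of [y] lie in [S], so [y] stays in the boundary; both ends of [x] lie outside [S1], so
   [x] leaves it. *)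
have := Sx e' e'T; have := S1y e' e'T; case: e' e'T => [z|] zT //.
rewrite /= !inE; have [->|zy] := eqVneq z y.
  have yS' : y.1 \in S.
    by case/orP: yc => /eqP yc; [|rewrite yS]; rewrite yc.
  by rewrite -yS yS' !eqxx => ->.
have inlE (u v : crossing D * bool) :
  (inl u == inl v :> semiarc D) = (u == v) by [].
rewrite !inlE (negPf zy); have [->|_] := eqVneq z x; last first.
  by do 4!case: (_ \in _).
have : x.1 \notin S1 \/ (Defs.glue D x).1 \notin S1.
  by move: cS1; rewrite /c; case: ifP; [left | right].
by case=> /negPf ->; case: (_ \in S1) => //; rewrite !andbF.
Qed.

End Consistency.

Lemma region_map_exists : exists f : region D -> P,
  f (unbounded D) = p0 /\
  forall e, sigma e (f (right_region e)) = f (left_region e).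
Proof.
(* Without semi-arcs a constant map works; otherwise [e0] is a dummy parent edge for the unbounded
   region. *)
have [e0 _|no_edge] := pickP (@predT (semiarc D)); last first.
  by exists (fun=> p0); split=> // e; have := no_edge e.
have [rank rankP] := ranking_exists (@region_connected D).
have /fin_all_exists[pe peP] r : exists e : semiarc D, r != unbounded D ->
    (left_region e == r) || (right_region e == r) /\
    (rank (other_region e r) < rank r)%N.
  have [->|/rankP[r' /existsP[e re] lt_r]] := eqVneq r (unbounded D).
    by exists e0.
  exists e => _; rewrite /other_region.
  case/orP: re => /andP[/eqP le /eqP re]; rewrite le re eqxx ?orbT //.
  by split=> //; case: eqP => // r'r; move: lt_r; rewrite r'r ltnn.
pose step r p := if left_region (pe r) == r then sigma (pe r) p else tau (pe r) p.
have [f [f0 fE]] := rank_recursion p0 step (fun r ru => (peP r ru).2).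
exists f; split=> //; apply: (consistent_cotree (T := tree pe)) => [|e].
  move=> _ /imsetP[r ru ->]; rewrite !inE in ru; have [pr _] := peP r ru.
  have := fE r ru; rewrite /consistent /step /other_region.
  case: eqP pr => /= [le _ fr|_ /eqP re fr]; first by rewrite le fr.
  by rewrite re fr tauK.
by apply: (cotree_cut (rank := rank)) => r ru; have [] := peP r ru.
Qed.

End Transport.

(** * The map psi and the colorings *)

Section PsiBijection.
Variable X : biquandleType.
Implicit Types (p q : As (quandle_of X)) (a b x y : X).

Lemma psi_word_bij (f : X -> X) (w : as_word (quandle_of X)) :
  bijective f -> bijective (psi_word f w).
Proof.
elim: w f => //= -[b s] w IHw f f_bij; apply: IHw; rewrite /psi_step /=.
case: s; first exact: bij_comp (bov_bij _) f_bij.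
apply: (@bij_comp _ _ _ (fun x => x /o bk (f b)) f) f_bij.
by exists (fun x => x *o bk (f b)) => x; rewrite (bovK, bovKV).
Qed.

Lemma psi_bij p : bijective (psi p).
Proof. by apply: psi_word_bij; exists id. Qed.

Definition psiV p x : X := xget x [set a | psi p a = x]%classic.

Lemma psiVK p x : psi p (psiV p x) = x.
Proof.
have [g _ gK] := psi_bij p.
by apply: (xgetPex x (P := [set a | psi p a = x]%classic)); exists (g x); exact: gK.
Qed.

Lemma psiK p a : psiV p (psi p a) = a.
Proof. by apply: (bij_inj (psi_bij p)); rewrite psiVK. Qed.

(* The region color on the left of a semi-arc with biquandle color x whose right
   region has color p. *)
Definition cross x p : As (quandle_of X) := (p * as_gen (psiV p x : quandle_of X))%g.

(** If [x = psi p a] and [q = p * as_gen a], then [psi q a = x *o x], so [a] can be read off from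
    the left region. *)
Definition uncross x q : As (quandle_of X) :=
  (q * (as_gen (psiV q (x *o x) : quandle_of X))^-1)%g.

Lemma crossK x : cancel (cross x) (uncross x).
Proof.
move=> p; rewrite /uncross /cross; set a := psiV p x.
suff -> : psiV (p * as_gen (a : quandle_of X))%g (x *o x) = a by rewrite mulgK.
by rewrite -{1 2}(psiVK p x) -/a -psi_gen psiK.
Qed.

Lemma uncrossK x : cancel (uncross x) (cross x).
Proof.
move=> q; rewrite /cross /uncross; set a := psiV q (x *o x).
suff -> : psiV (q * (as_gen (a : quandle_of X))^-1)%g x = a by rewrite mulgVK.
have {1}-> : x = psi (q * (as_gen (a : quandle_of X))^-1)%g a.
  by rewrite psi_genV psiVK bkK bovK.
exact: psiK.
Qed.

(** Passing over a strand keeps the quandle color; only the region from which it is read changes. *)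
Lemma psiV_cross_over p x y : psiV (cross x p) (y *o x) = psiV p y.
Proof. by rewrite -{1}(psiVK p y) -{2}(psiVK p x) -psi_gen psiK. Qed.

Lemma psiV_cross_under p x y :
  psiV (cross y p) (x *u y) = quandle_of_op (psiV p x) (psiV p y).
Proof.
by rewrite -{1}(psiVK p x) -{2}(psiVK p y) -psi_op -psi_gen psiK.
Qed.

(** In terms of quandle colors this is the defining relation of the associated group. *)
Lemma cross_crossing p x y :
  cross (y *o x) (cross x p) = cross (x *u y) (cross y p).
Proof.
rewrite {1}/cross psiV_cross_over [RHS]/cross psiV_cross_under /cross.
by rewrite -!mulgA as_gen_comm.
Qed.

End PsiBijection.

Section PsiColorings.
Variables (D : diagram) (X : biquandleType).
Local Notation Q := (quandle_of X).
Implicit Types (C : {ffun Defs.arc D -> Q}) (Y : {ffun semiarc D -> X}).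

Lemma same_arc_crossing (c : crossing D) : same_arc (over_spec c) (over_opp c).
Proof.
apply: connect1; rewrite /over_spec /over_opp /=.
have io : passes_over (incoming c true) (outgoing c true).
  by apply/existsP; exists c; rewrite !eqxx.
by case: (positive c); rewrite io ?orbT.
Qed.

Lemma same_arc_sym : connect_sym [rel s t : semiarc D | passes_over s t || passes_over t s].
Proof. by apply: sym_connect_sym => s t /=; rewrite orbC. Qed.

Lemma arc_of_same_arc (s t : semiarc D) : same_arc s t -> arc_of s = arc_of t.
Proof.
move=> st; apply/val_inj/setP => u; rewrite !inE.
exact: (same_connect same_arc_sym).
Qed.

Lemma same_arc_of (s t : semiarc D) : arc_of s = arc_of t -> same_arc s t.
Proof. by move/(congr1 val)/setP/(_ t); rewrite !inE /same_arc connect0. Qed.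

Lemma arc_of_surj (B : Defs.arc D) : exists s, arc_of s = B.
Proof.
case: B => B BP; have /existsP[s /eqP BE] := BP; exists s.
exact/val_inj/esym.
Qed.

Lemma arc_of_over (c : crossing D) : arc_of (over_spec c) = arc_of (over_opp c).
Proof. exact/arc_of_same_arc/same_arc_crossing. Qed.

(** Right multiplications by the colors commute around a crossing by [as_gen_comm], so they
    integrate. *)
Lemma region_coloringP C : qnd_coloring C ->
  is_region_coloring C (region_coloring C).
Proof.
move=> CP; apply: (xgetPex _ (P := [set CR | is_region_coloring C CR]%classic)).
have [||c p|f [f1 fE]] := @region_map_exists D (As Q) 1%g
  (fun e p => p * as_gen (C (arc_of e)))%g (fun e p => p * (as_gen (C (arc_of e)))^-1)%g.
- by move=> e p; rewrite mulgK.
- by move=> e p; rewrite mulgVK.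
- by rewrite -arc_of_over -CP -!mulgA as_gen_comm.
by exists [ffun r => f r]; split=> [|e]; rewrite !ffunE.
Qed.

Lemma psi_arc C s : psi (region_coloring C (right_region s)) (C (arc_of s)) = Psi C s.
Proof. by rewrite ffunE. Qed.

Lemma cross_region_coloring C s : qnd_coloring C ->
  cross (Psi C s) (region_coloring C (right_region s))
  = region_coloring C (left_region s).
Proof.
by move/region_coloringP=> [_ CR]; rewrite -CR -psi_arc /cross psiK.
Qed.

Lemma Psi_coloring C : qnd_coloring C -> bq_coloring (Psi C).
Proof.
move=> CP c; have [_ CR] := region_coloringP CP.
rewrite -!psi_arc -corner_over -corner_under -!CR -corner_spec -arc_of_over.
by rewrite !psi_gen -CP psi_op.
Qed.

(** Both region colorings integrate the same maps [cross], hence agree; then each [psi p] is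
    injective. *)
Lemma Psi_inj C C' : qnd_coloring C -> qnd_coloring C' -> Psi C = Psi C' -> C = C'.
Proof.
move=> CP C'P CC'.
have RR' : region_coloring C =1 region_coloring C'.
  apply: (@region_map_unique D _ _ _ (fun e => crossK (Psi C e))).
  - by rewrite (region_coloringP CP).1 (region_coloringP C'P).1.
  - by move=> e; apply: cross_region_coloring.
  - by move=> e; rewrite CC'; apply: cross_region_coloring.
apply/ffunP=> B; have [s <-] := arc_of_surj B.
apply: (bij_inj (psi_bij (region_coloring C (right_region s)))).
by rewrite {2}RR' !psi_arc CC'.
Qed.

(** The region colors come first, by integrating [cross]; [psiV] then gives the quandle colors,
    constant on arcs. *)
Lemma Psi_surj Y : bq_coloring Y -> exists2 C, qnd_coloring C & Psi C = Y.
Proof.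
move=> YP.
have [|f [f1 fE]] := @region_map_exists D (As Q) 1%g (fun e => cross (Y e))
  (fun e => uncross (Y e)) (fun e => @crossK _ _) (fun e => @uncrossK _ _).
  by move=> c p; have [<- <-] := YP c; apply: cross_crossing.
pose g s : Q := psiV (f (right_region s)) (Y s).
have g_over c : g (over_opp c) = g (over_spec c).
  rewrite /g -(YP c).2 -corner_under -fE psiV_cross_over.
  by rewrite corner_spec.
have g_arc s t : same_arc s t -> g s = g t.
  have g1 u v : passes_over u v -> g u = g v.
    case/existsP=> c /andP[/eqP -> /eqP ->]; have := g_over c.
    by rewrite /over_opp /over_spec; case: positive.
  case/connectP=> p pP ->; elim: p s pP => //= u p IHp s /andP[su /IHp <-].
  by case/orP: su => /g1.
have /fin_all_exists[h hP] := arc_of_surj.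
pose C : {ffun Defs.arc D -> Q} := [ffun B => g (h B)].
have CE s : C (arc_of s) = g s by rewrite ffunE; apply/g_arc/same_arc_of/hP.
have CP : qnd_coloring C.
  move=> c; rewrite !CE /g -corner_over -fE -(YP c).1 psiV_cross_under.
  by rewrite corner_spec.
have fR : f =1 region_coloring C.
  have [R1 RE] := region_coloringP CP.
  apply: (@region_map_unique D _ (fun e p => p * as_gen (C (arc_of e)))%g
    (fun e p => p * (as_gen (C (arc_of e)))^-1)%g) => //; last 1 first.
  - by move=> e; rewrite CE -fE.
  - by move=> e p; rewrite mulgK.
  - by rewrite R1.
by exists C => //; apply/ffunP=> s; rewrite -psi_arc CE -fR psiVK.
Qed.

End PsiColorings.

Theorem theorem5p1 (X : biquandleType) (A : zmodType)
    (theta : bq_cocycle X A) (D : diagram) :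
  [/\ set_bij (@qnd_coloring D (quandle_of X)) (@bq_coloring D X) (@Psi D X),
      (forall C, @qnd_coloring D (quandle_of X) C ->
         bq_weight theta (Psi C) = shadow_weight (pullback theta) C)
    & finite_set [set: X]%classic ->
      bq_invariant D theta = shadow_invariant D (pullback theta)].
Proof.
have Psi_bij : set_bij (@qnd_coloring D (quandle_of X)) (@bq_coloring D X) (@Psi D X).
  split=> [C|C C'|Y] /=; first exact: Psi_coloring.
    by rewrite !inE; apply: Psi_inj.
  by move/Psi_surj=> [C CP <-]; exists C.
have weightE (C : {ffun Defs.arc D -> quandle_of X}) :
    bq_weight theta (Psi C) = shadow_weight (pullback theta) C.
  (* Both strands have the specified region on their right, so both colors are read with the same
     [p]. *)
  apply: eq_bigr => c _; rewrite -!psi_arc /= /pullback_fun.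
  by rewrite /spec_region_crossing corner_spec.
split=> // _; rewrite /bq_invariant (reindex_fsbig _ _ _ _ Psi_bij).
by apply: eq_fsbigr => C _; rewrite weightE.
Qed.
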